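(* Let $\Sigma=\{1,\ldots,m\}$ be an alphabet of size $m\ge 2$. We have $$\#(\Sigma^n/\!\sim_2)\in\Theta\left(n^{m^2-1}\right)$$ when $n$ tends to infinity.
   Context: $\Sigma^n$ is the set of words of length $n$ over $\Sigma$. For words $u,x$, $\binom{u}{x}$ is the number of times $x$ appears as a (not necessarily contiguous) subsequence of $u$. Two words $u,v$ are $2$-binomially equivalent, $u\sim_2 v$, if $\binom{u}{x}=\binom{v}{x}$ for all words $x$ of length at most $2$. $\#(\Sigma^n/\!\sim_2)$ is the number of $\sim_2$-classes of words of length $n$. $f\in\Theta(g)$ means that there exist constants $A,B>0$ such that $A\,g(n)\le f(n)\le B\,g(n)$ for all $n$ large enough. *)

(* Defs.v *)
From mathcomp Require Import all_boot all_order all_algebra.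
From mathcomp Require Import reals.

Set Implicit Arguments.
Unset Strict Implicit.
Unset Printing Implicit Defensive.

Import Order.TTheory GRing.Theory Num.Theory.

(* A bit mask on the letters of [u] is a set of positions of [u], so distinct
   sets of positions that spell the same word [x] are counted separately. *)
Definition word_binom (T : eqType) (u x : seq T) : nat :=
  #|[set b : (size u).-tuple bool | mask b u == x]|.

(* Boolean form of "[word_binom u x = word_binom v x] for all words [x] of
   length at most [k]"; see [binom_eqvP]. *)
Definition binom_eqv (k : nat) (T : finType) (u v : seq T) : bool :=
  [forall l : 'I_k.+1, forall x : l.-tuple T,
     word_binom u x == word_binom v x].

Lemma binom_eqvP (k : nat) (T : finType) (u v : seq T) :
  reflect (forall x : seq T, size x <= k -> word_binom u x = word_binom v x)
          (binom_eqv k u v).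
Proof.
apply: (iffP idP) => [eq_uv x le_xk | eq_uv].
  have /forallP/(_ (in_tuple x))/eqP// :=
    forallP eq_uv (Ordinal (le_xk : size x < k.+1)).
apply/forallP=> l; apply/forallP=> x; apply/eqP/eq_uv.
by rewrite size_tuple -ltnS.
Qed.

Lemma binom_eqv_equivalence (k : nat) (T : finType) :
  equivalence_rel (@binom_eqv k T).
Proof.
move=> u v w; split=> [|/binom_eqvP eq_uv]; first exact/binom_eqvP.
by apply/binom_eqvP/binom_eqvP => H x lx; rewrite -H // eq_uv.
Qed.

Definition num_binom_classes (k : nat) (T : finType) (n : nat) : nat :=
  #|equivalence_partition (fun u v : n.-tuple T => binom_eqv k u v)
                          [set: n.-tuple T]|.

Definition is_Theta (R : realType) (f g : nat -> R) : Prop :=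
  exists A B : R, [/\ (0 < A)%R, (0 < B)%R &
    exists N : nat, forall n : nat, N <= n ->
      (A * g n <= f n)%R /\ (f n <= B * g n)%R].

(* Main.v *)
Require Import Defs.
From mathcomp Require Import all_boot all_order all_algebra.
From mathcomp Require Import reals.
From mathcomp Require Import zify.

(** The [~_2]-class of a word is determined by its letter counts and by the
    numbers of subsequences [ab] with [a < b], since the counts of [ab] and
    [ba] add up to the product of the letter counts.  Writing each count of
    [ab], which is at most [n ^ 2], with two digits in base [n + 1] and dropping
    the redundant count of the last letter, a class is encoded by [m ^ 2 - 1]
    digits.  Conversely, given [m ^ 2 - 1] digits in base [k], with [n] at least
    a constant times [k], we concatenate for all [a < b] a word with [k] letters
    [a], [k] letters [b] and a prescribed number [q * k + r] of subsequences
    [ab], then add a prescribed number of copies of each letter but the last and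
    pad with the last letter; the counts of this word recover all digits. *)

(** * Counting equivalence classes through codes *)

Lemma card_equivalence_partition_le (T X : finType) (R : rel T) (f : T -> X)
    (A : {pred X}) :
    equivalence_rel R -> (forall u, f u \in A) ->
    (forall u v, f u = f v -> R u v) ->
  #|equivalence_partition R [set: T]| <= #|A|.
Proof.
move=> eqR fA fR.
(* [K] sends a code to the class of some element having it; by [fR] the choice does not matter. The
   value [set0] serves the codes that are not attained. *)
pose K x := if [pick u | f u == x] is Some u
            then [set v in [set: T] | R u v] else set0.
apply: leq_trans (leq_imset_card K A); apply: subset_leq_card.
apply/subsetP=> _ /imsetP[u _ ->]; apply/imsetP; exists (f u) => //.
rewrite /K; case: pickP => [v /eqP/fR Rvu | /(_ u)]; last by rewrite eqxx.
apply/setP=> w; rewrite !inE.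
by have [_ /(_ Rvu) ->] := eqR v u w.
Qed.

Lemma card_equivalence_partition_ge (T X : finType) (R : rel T) (h : X -> T)
    (A : {pred X}) :
    equivalence_rel R -> {in A &, forall x y, R (h x) (h y) -> x = y} ->
  #|A| <= #|equivalence_partition R [set: T]|.
Proof.
move=> eqR hR.
pose cl x := [set v in [set: T] | R (h x) v].
rewrite -(card_in_imset (f := cl)) => [|x y xA yA /setP/(_ (h y))].
  apply/subset_leq_card/subsetP=> _ /imsetP[x _ ->].
  by apply/imsetP; exists (h x).
rewrite !inE /= => E; apply: hR => //; rewrite E.
by have [] := eqR (h y) (h y) (h y).
Qed.

(** * Subsequence counts for words of length at most two *)

Lemma word_binom_nil (T : eqType) (x : seq T) : word_binom [::] x = (x == [::]).
Proof.
rewrite /word_binom -sum1dep_card (eq_bigl (fun=> x == [::])) => [|b].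
  by case: eqP => _; rewrite ?big_pred0_eq // sum1_card card_tuple expn0.
by rewrite tuple0 eq_sym.
Qed.

(** Masks are split by their first bit: a false bit skips [c], a true bit matches [c] with the first
    letter of [x]. *)
Lemma word_binom_cons (T : eqType) (c : T) (u x : seq T) :
  word_binom (c :: u) x =
    word_binom u x
    + (if x is y :: w then (c == y) * word_binom u w else 0).
Proof.
rewrite /word_binom -!sum1dep_card /=.
rewrite (reindex (fun p : bool * (size u).-tuple bool => cons_tuple p.1 p.2)) /=; last first.
  exists (fun b => (thead b, behead_tuple b)) => [[a b] _ | b _] /=.
    by congr pair; apply/val_inj.
  by rewrite [RHS]tuple_eta.
rewrite -(pair_big_dep xpredT
  (fun a (b : (size u).-tuple bool) => mask (a :: b) (c :: u) == x)
  (fun _ _ => 1)) /= big_bool /= addnC; congr addn.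
case: x => [|y w]; first by rewrite big_pred0.
under eq_bigl do rewrite eqseq_cons.
by case: eqP => _; rewrite ?mul1n -?sum1dep_card ?big_pred0_eq.
Qed.

Lemma word_binom0 (T : eqType) (u : seq T) : word_binom u [::] = 1.
Proof.
by elim: u => [|c u IH]; rewrite ?word_binom_nil // word_binom_cons addn0.
Qed.

Lemma word_binom1 (T : eqType) (u : seq T) a :
  word_binom u [:: a] = count_mem a u.
Proof.
elim: u => [|c u IH]; rewrite ?word_binom_nil // word_binom_cons /=.
by rewrite word_binom0 IH muln1 addnC.
Qed.

Lemma word_binom2_cons (T : eqType) (c : T) u a b :
  word_binom (c :: u) [:: a; b] =
    word_binom u [:: a; b] + (c == a) * count_mem b u.
Proof. by rewrite word_binom_cons word_binom1. Qed.

Lemma word_binom2_cat (T : eqType) (u v : seq T) a b :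
  word_binom (u ++ v) [:: a; b] =
    word_binom u [:: a; b] + word_binom v [:: a; b]
    + count_mem a u * count_mem b v.
Proof.
elim: u => [|c u IH]; first by rewrite word_binom_nil addn0.
by rewrite cat_cons !word_binom2_cons IH count_cat /=; lia.
Qed.

(** An occurrence of [a] and one of [b] come in one of the two orders or, when [a = b], may be the
    same position; the third term counts these coincidences. *)
Lemma word_binom2_swap (T : eqType) (u : seq T) a b :
  word_binom u [:: a; b] + word_binom u [:: b; a] + (a == b) * count_mem a u
    = count_mem a u * count_mem b u.
Proof.
elim: u => [|c u IH]; first by rewrite !word_binom_nil muln0.
rewrite !word_binom2_cons /=; move: IH.
have [<-|ab] := eqVneq a b; first by case: eqP => _ /=; lia.
have [->|_] := eqVneq c a; first by rewrite (negPf ab) /=; lia.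
by case: eqP => _ /=; lia.
Qed.

Lemma word_binom2_le (T : eqType) (u : seq T) a b :
  word_binom u [:: a; b] <= count_mem a u * count_mem b u.
Proof. by rewrite -word_binom2_swap -addnA leq_addr. Qed.

Lemma word_binom2_nseq (T : eqType) k (c a b : T) :
  a != b -> word_binom (nseq k c) [:: a; b] = 0.
Proof.
move=> ab; apply/eqP; rewrite -leqn0 (leq_trans (word_binom2_le _ _ _ _)) //.
rewrite !count_nseq /=.
by have [->|] := eqVneq c a; rewrite ?(negPf ab) ?mul0n ?muln0.
Qed.

Lemma binom_eqv2P (T : finType) (u v : seq T) :
  reflect ((forall a, count_mem a u = count_mem a v) /\
           (forall a b, word_binom u [:: a; b] = word_binom v [:: a; b]))
          (binom_eqv 2 u v).
Proof.
apply: (iffP (binom_eqvP _ _ _)) => [E | [E1 E2] [|a [|b [|//]]] _].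
- by split=> [a|a b]; rewrite -?word_binom1 E.
- by rewrite !word_binom0.
- by rewrite !word_binom1.
- exact: E2.
Qed.

Lemma sum_count_mem (T : finType) (u : seq T) :
  \sum_(a : T) count_mem a u = size u.
Proof.
elim: u => [|c u IH]; first by rewrite big1.
rewrite big_split /= IH (bigD1 c) //= eqxx big1 ?addn0 // => a /negPf.
by rewrite eq_sym => ->.
Qed.

Lemma count_flatten_eq (T : eqType) (I : Type) (w w' : I -> seq T) a s :
    (forall i, count_mem a (w i) = count_mem a (w' i)) ->
  count_mem a (flatten (map w s)) = count_mem a (flatten (map w' s)).
Proof. by move=> E; elim: s => //= i s IH; rewrite !count_cat E IH. Qed.

(** Occurrences of [ab] across two different blocks depend on letter counts alone, so replacing [w]
    by [w'] changes only the counts inside blocks. The crosswise sums avoid subtraction. *)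
Lemma word_binom2_flatten (T : eqType) (I : Type) (w w' : I -> seq T) a b s :
    (forall c i, count_mem c (w i) = count_mem c (w' i)) ->
  word_binom (flatten (map w s)) [:: a; b]
      + \sum_(i <- s) word_binom (w' i) [:: a; b]
    = word_binom (flatten (map w' s)) [:: a; b]
      + \sum_(i <- s) word_binom (w i) [:: a; b].
Proof.
move=> E; elim: s => [|i s IH]; first by rewrite !big_nil.
rewrite /= !big_cons !word_binom2_cat E.
rewrite (count_flatten_eq _ _ w w' b s (E b)); lia.
Qed.

(** For [q, r < k], all [k] letters [a] precede the last [q] letters [b], and exactly [r] of them
    precede the isolated [b]; the leading [b]s only fix the letter count. This gives [q * k + r]
    subsequences [ab]. *)
Definition pair_block (T : Type) (k q r : nat) (a b : T) : seq T :=
  nseq (k - q.+1) b ++ nseq r a ++ b :: nseq (k - r) a ++ nseq q b.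

Lemma size_pair_block (T : Type) k q r (a b : T) :
  q < k -> r < k -> size (pair_block T k q r a b) = 2 * k.
Proof.
by move=> *; rewrite /pair_block !size_cat /= size_cat !size_nseq; lia.
Qed.

Lemma count_pair_block (T : eqType) k q r (a b c : T) : q < k -> r < k ->
  count_mem c (pair_block T k q r a b) = (a == c) * k + (b == c) * k.
Proof.
move=> *; rewrite /pair_block !count_cat /= count_cat !count_nseq /=.
by case: (a == c); case: (b == c); lia.
Qed.

Lemma word_binom2_pair_block (T : eqType) k q r (a b : T) :
    a != b -> q < k -> r < k ->
  word_binom (pair_block T k q r a b) [:: a; b] = q * k + r.
Proof.
move=> ab lqk lrk; rewrite /pair_block !(word_binom2_cat, word_binom2_cons).
rewrite !word_binom2_nseq // !count_cat /= count_cat !count_nseq /=.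
by rewrite !eqxx eq_sym (negPf ab) /=; nia.
Qed.

(** * Upper bound: the code of a word *)

Section Encoding.

Variable m : nat.
Local Notation letter := 'I_m.+1.
Local Notation word_code k := {ffun letter * letter -> 'I_k.+1}.

(** For [a < b], the high digit of the count of [ab] sits at [(a, b)] and the low digit at [(b, a)];
    the diagonal holds letter counts. The excluded corner is the count of the last letter. *)
Definition free_index : pred (letter * letter) :=
  [pred p | p != (ord_max, ord_max)].

Lemma card_code k :
  #|pffun_on (ord0 : 'I_k.+1) free_index predT| = k.+1 ^ (m.+1 ^ 2 - 1).
Proof.
rewrite card_pffun_on card_ord cardC1 card_prod !card_ord.
by congr (_ ^ _); rewrite subn1 -mulnn.
Qed.

Definition code_of_word n (u : seq letter) : word_code n :=
  [ffun p : letter * letter =>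
    inord (if p.1 < p.2 then word_binom u [:: p.1; p.2] %/ n.+1
           else if p.2 < p.1 then word_binom u [:: p.2; p.1] %% n.+1
           else if p.1 == ord_max then 0 else count_mem p.1 u)].

Lemma code_of_word_on n u :
  code_of_word n u \in pffun_on ord0 free_index predT.
Proof.
apply/pffun_onP; split=> //; apply/supportP=> p.
rewrite !inE negbK => /eqP ->.
by rewrite ffunE ltnn eqxx; apply/val_inj; rewrite /= inordK.
Qed.

Lemma code_of_word_eqv n (u v : n.-tuple letter) :
  code_of_word n u = code_of_word n v -> binom_eqv 2 u v.
Proof.
move=> /ffunP E.
(* These two bounds ensure that [inord] never falls back on its default value, so digits can be read
   back. *)
have cnt_lt (w : n.-tuple letter) a : count_mem a w < n.+1.
  by rewrite ltnS -[leqRHS](size_tuple w) count_size.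
have bin_lt (w : n.-tuple letter) a b : word_binom w [:: a; b] %/ n.+1 < n.+1.
  rewrite ltn_divLR // (leq_ltn_trans (word_binom2_le _ _ _ _)) //.
  by rewrite ltn_mul.
have cntE a : a != ord_max -> count_mem a u = count_mem a v.
  move=> aN; have := E (a, a); rewrite !ffunE /= ltnn (negPf aN).
  by move/(congr1 val); rewrite /= !inordK.
have cntT a : count_mem a u = count_mem a v.
  have [->|/cntE //] := eqVneq a ord_max.
  (* The count of the last letter is the common length minus the other counts. *)
  have := etrans (size_tuple u) (esym (size_tuple v)).
  rewrite -!sum_count_mem (bigD1 ord_max) // [RHS](bigD1 ord_max) //=.
  by rewrite (eq_bigr _ cntE) => /addIn.
have binE (a b : letter) : a < b -> word_binom u [:: a; b] = word_binom v [:: a; b].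
  move=> ab.
  have := E (a, b); have := E (b, a); rewrite !ffunE /= ab ltnNge (ltnW ab) /=.
  move=> /(congr1 val) /=; rewrite !inordK ?ltn_mod // => Emod.
  move=> /(congr1 val) /=; rewrite !inordK // => Ediv.
  by rewrite (divn_eq (word_binom u _) n.+1) Ediv Emod -divn_eq.
apply/binom_eqv2P; split=> // a b.
(* Given equal letter counts, this identity yields the case [b < a] from [binE], and determines
   twice the count of [aa]. *)
have := word_binom2_swap _ u a b; have := word_binom2_swap _ v a b.
rewrite !cntT; case: (ltngtP a b) => [/binE //|/binE -> <- /eqP|/val_inj <-].
  by rewrite !eqn_add2r => /eqP.
by move=> <- /addIn; rewrite !addnn => /double_inj.
Qed.

Lemma num_binom_classes2_le n :
  num_binom_classes 2 letter n <= n.+1 ^ (m.+1 ^ 2 - 1).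
Proof.
rewrite -card_code /num_binom_classes.
apply: (card_equivalence_partition_le _ _ _
          (fun u : n.-tuple letter => code_of_word n u)).
- by move=> u v w; apply: binom_eqv_equivalence.
- by move=> u; apply: code_of_word_on.
- exact: code_of_word_eqv.
Qed.

(** * Lower bound: a word for every code *)

Definition ordered_pair := [pred p : letter * letter | p.1 < p.2].

Definition code_block k (g : word_code k) (p : letter * letter) : seq letter :=
  pair_block letter k.+1 (g p) (g (p.2, p.1)) p.1 p.2.

Definition code_blocks k (g : word_code k) : seq letter :=
  flatten [seq code_block k g p | p <- enum ordered_pair].

Definition code_diag k (g : word_code k) : seq letter :=
  flatten [seq nseq (g (a, a)) a | a <- enum letter].

Definition code_prefix k (g : word_code k) : seq letter :=
  code_blocks k g ++ code_diag k g.

Definition word_of_code k n (g : word_code k) : seq letter :=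
  code_prefix k g ++ nseq (n - size (code_prefix k g)) ord_max.

Lemma size_code_blocks k (g : word_code k) :
  size (code_blocks k g) = 2 * k.+1 * #|ordered_pair|.
Proof.
rewrite /code_blocks cardE.
elim: (enum _) => [|p s IH]; first by rewrite muln0.
by rewrite /= size_cat IH size_pair_block // -mulnS.
Qed.

(** The prefix must fit into length [n], as the padding length is a truncated difference. The blocks
    take at most [2 * m.+1 ^ 2 * k.+1] letters and the diagonal part at most [m.+1 * k.+1], whence
    the factor 3. *)
Lemma size_word_of_code k n (g : word_code k) :
  3 * m.+1 ^ 2 * k.+1 <= n -> size (word_of_code k n g) = n.
Proof.
move=> le_n; rewrite size_cat size_nseq subnKC //; apply: leq_trans le_n.
rewrite size_cat size_code_blocks.
have := max_card ordered_pair.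
rewrite card_prod card_ord mulnn => le_pair.
have le_diag : size (code_diag k g) <= m.+1 * k.+1.
  rewrite /code_diag -[m.+1 in leqRHS](size_enum_ord m.+1).
  elim: (enum _) => //= a s IH; rewrite size_cat size_nseq mulSn.
  by rewrite leq_add // ltnW.
rewrite -[3]/(2 + 1) mulnDl mulnDl mul1n mulnAC leq_add ?leq_mul //.
by rewrite (leq_trans le_diag) // leq_mul // -mulnn leq_pmulr.
Qed.

Lemma count_code_block k (g h : word_code k) a p :
  count_mem a (code_block k g p) = count_mem a (code_block k h p).
Proof. by rewrite !count_pair_block. Qed.

Lemma count_code_blocks k (g h : word_code k) a :
  count_mem a (code_blocks k g) = count_mem a (code_blocks k h).
Proof. exact/count_flatten_eq/count_code_block. Qed.

Lemma count_code_diag k (g : word_code k) a :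
  count_mem a (code_diag k g) = g (a, a).
Proof.
rewrite /code_diag count_flatten -map_comp sumnE big_map big_enum /=.
rewrite (bigD1 a) //= count_nseq /= eqxx mul1n big1 ?addn0 // => b ba.
by rewrite count_nseq /= (negPf ba).
Qed.

(** A block has only the two letters of its pair, and increasing pairs are determined by their sets
    of letters, so any other block misses [a] or [b]. *)
Lemma word_binom2_code_block k (g : word_code k) (p : letter * letter)
    (a b : letter) :
    p.1 < p.2 -> a < b -> p != (a, b) ->
  word_binom (code_block k g p) [:: a; b] = 0.
Proof.
case: p => c d /= cd ab pN; apply/eqP; rewrite -leqn0.
apply: leq_trans (word_binom2_le _ _ _ _) _.
rewrite !count_pair_block //= leqn0 muln_eq0 !addn_eq0 !muln_eq0 !eqb0 !orbF.
rewrite -!(inj_eq val_inj) /=.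
by move: pN; rewrite xpair_eqE -!(inj_eq val_inj) /=; lia.
Qed.

(** Letter counts of blocks do not depend on the code, so cross terms cancel and only the block of
    [(a, b)] remains; its count is then read in base [k.+1]. *)
Lemma code_blocks_inj k (g h : word_code k) (a b : letter) : a < b ->
    word_binom (code_blocks k g) [:: a; b] =
      word_binom (code_blocks k h) [:: a; b] ->
  g (a, b) = h (a, b) /\ g (b, a) = h (b, a).
Proof.
move=> ab E.
have := word_binom2_flatten _ _ _ _ a b (enum ordered_pair)
          (count_code_block k g h).
rewrite -/(code_blocks k g) -/(code_blocks k h) E => /addnI H.
have sumE (f : word_code k) :
    \sum_(p <- enum ordered_pair)
      word_binom (code_block k f p) [:: a; b] = f (a, b) * k.+1 + f (b, a).
  rewrite big_enum /= (bigD1 (a, b)) //= big1 => [|p /andP[]].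
    by rewrite addn0 word_binom2_pair_block // neq_ltn ab.
  by move=> *; apply: word_binom2_code_block.
rewrite !sumE in H.
have := congr1 (modn^~ k.+1) H; rewrite !modnMDl !modn_small // => /val_inj E1.
move: H; rewrite E1 => /addIn/eqP; rewrite eqn_pmul2r // => /eqP/val_inj ->.
by [].
Qed.

Lemma word_of_code_inj k n :
  {in pffun_on (ord0 : 'I_k.+1) free_index predT &, forall g h,
    binom_eqv 2 (word_of_code k n g) (word_of_code k n h) -> g = h}.
Proof.
move=> g h /pffun_onP[/supportP g0 _] /pffun_onP[/supportP h0 _].
move=> /binom_eqv2P[Ecnt Ebin].
have diagE a : g (a, a) = h (a, a).
  (* At the last letter both codes vanish by their support; the padding adds no other letter. *)
  have [->|aN] := eqVneq a ord_max; first by rewrite g0 ?h0 // !inE eqxx.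
  have := Ecnt a; rewrite !count_cat !count_nseq /= !count_code_diag.
  rewrite (count_code_blocks k g h) eq_sym (negPf aN) !mul0n !addn0.
  by move=> /addnI/val_inj.
have Ediag : code_diag k g = code_diag k h.
  by rewrite /code_diag; under eq_map do rewrite diagE.
have blocksE (a b : letter) : a < b -> g (a, b) = h (a, b) /\ g (b, a) = h (b, a).
  (* Blocks have the same total size for both codes, so by [Ediag] the two words share everything
     after the blocks, and the contribution of this tail cancels. *)
  move=> ab; apply: code_blocks_inj => //; have := Ebin a b.
  rewrite /word_of_code /code_prefix Ediag !size_cat !size_code_blocks -!catA.
  rewrite !(word_binom2_cat _ (code_blocks _ _)) (count_code_blocks k g h).
  by move=> /addIn/addIn.
apply/ffunP=> -[a b]; case: (ltngtP a b) => [/blocksE[]|/blocksE[]|/val_inj ->] //.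
Qed.

Lemma num_binom_classes2_ge k n :
    3 * m.+1 ^ 2 * k.+1 <= n ->
  k.+1 ^ (m.+1 ^ 2 - 1) <= num_binom_classes 2 letter n.
Proof.
move=> le_n; rewrite -card_code /num_binom_classes.
pose h (g : word_code k) : n.-tuple letter :=
  Tuple (introT eqP (size_word_of_code k n g le_n)).
apply: (card_equivalence_partition_ge _ _ _ h).
- by move=> u v w; apply: binom_eqv_equivalence.
- exact: word_of_code_inj.
Qed.

End Encoding.

Theorem proposition13 (R : realType) (m : nat) (hm : 2 <= m) :
  is_Theta (fun n : nat => ((num_binom_classes 2 'I_m n)%:R : R)%R)
           (fun n : nat => ((n%:R : R) ^+ (m ^ 2 - 1)%N)%R).
Proof.
case: m hm => // m _; set E := (_ - 1)%N; pose D := 3 * m.+1 ^ 2.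
have D_gt0 : 0 < D by rewrite muln_gt0 expn_gt0.
(* With [k.+1 = n %/ D], one has [n < D * (k + 2) <= 2 * D * k.+1], which gives the lower constant;
   [n.+1 <= 2 * n] gives the upper one. *)
exists (((2 * D) ^ E)%:R^-1)%R, ((2 ^ E)%:R)%R; split.
- by rewrite Num.Theory.invr_gt0 Num.Theory.ltr0n expn_gt0 muln_gt0 D_gt0.
- by rewrite Num.Theory.ltr0n expn_gt0.
exists D => n le_Dn; rewrite -GRing.natrX; split.
  rewrite Num.Theory.ler_pdivrMl; last first.
    by rewrite Num.Theory.ltr0n expn_gt0 muln_gt0 D_gt0.
  rewrite -GRing.natrM Num.Theory.ler_nat.
  have := divn_gt0 n D_gt0; rewrite le_Dn; case Ek: (n %/ D) => [//|k] _.
  have le_n : D * k.+1 <= n by rewrite -Ek mulnC leq_trunc_div.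
  apply: leq_trans (leq_mul (leqnn _) (num_binom_classes2_ge m k n le_n)).
  rewrite -expnMn; have [->|E_gt0] := posnP E; first by rewrite !expn0.
  rewrite leq_exp2r //; have := ltn_ceil n D_gt0; rewrite Ek => ?; nia.
rewrite -GRing.natrM Num.Theory.ler_nat.
apply: leq_trans (num_binom_classes2_le m n) _; rewrite -/E -expnMn.
have [->|E_gt0] := posnP E; first by rewrite !expn0.
by rewrite leq_exp2r // mul2n -addnn -addn1 leq_add2l (leq_trans D_gt0 le_Dn).
Qed.
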